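(* Let $d_1,d_2,d_3$ be positive integers with $\gcd(d_1,d_2,d_3)=1$ and $3\le d_1<d_2<d_3\le d_1d_2-d_1-d_2$, such that none of them is a linear combination of the other two with non-negative integer coefficients, and let $S_3=\langle d_1,d_2,d_3\rangle$. Then the rescaled genus $h_3=K_3/g_3^4$ of $S_3$ satisfies $$0.02443<h_3<0.07515.$$
   Context: $S_3=\langle d_1,d_2,d_3\rangle$ is the numerical semigroup of all linear combinations of $d_1,d_2,d_3$ with non-negative integer coefficients. The Frobenius number $F_3$ is the largest positive integer not in $S_3$, and $g_3=F_3+d_1+d_2+d_3$. Put $\pi_3=d_1d_2d_3$. The Hilbert series $H(S_3;t)=\sum_{s\in S_3}t^s$ has the form $$H(S_3;t)=\frac{1-t^{x_1}-t^{x_2}-t^{x_3}+t^{y}+t^{g_3}}{(1-t^{d_1})(1-t^{d_2})(1-t^{d_3})},$$ where $x_1,x_2,x_3,y$ are the degrees of syzygies, with $0\le x_j,y<g_3$ (in the symmetric case two terms cancel, which corresponds to taking $y=x_3=0$). The coefficient $K_r$, $r\ge 0$, is determined by $$\bigl(y^{r+3}+g_3^{r+3}\bigr)-\bigl(x_1^{r+3}+x_2^{r+3}+x_3^{r+3}\bigr)=\frac{(r+3)!}{r!}\,K_r\,\pi_3 .$$ Equivalently, if $\sum_j c_jt^j$ denotes the polynomial $(1-t^{d_1})(1-t^{d_2})(1-t^{d_3})H(S_3;t)$, then $\frac{(r+3)!}{r!}K_r\pi_3=\sum_j c_j\,j^{r+3}$. *)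

(* Defs.v *)
From mathcomp Require Import all_boot all_order all_algebra.
From mathcomp Require Import ring zify.
Set Implicit Arguments.
Unset Strict Implicit.
Unset Printing Implicit Defensive.
Import Order.TTheory GRing.Theory Num.Theory.
Local Open Scope ring_scope.

(* The bound on the coefficients only makes membership decidable: it loses
   nothing, by semigroup3P below. *)
Definition semigroup3 (d1 d2 d3 : nat) : pred nat := fun n =>
  [exists a : 'I_n.+1, exists b : 'I_n.+1, exists c : 'I_n.+1,
     n == (a * d1 + b * d2 + c * d3)%N].

Definition is_frobenius (S : pred nat) (F : nat) : Prop :=
  [/\ (0 < F)%N, ~~ S F & forall n : nat, (F < n)%N -> S n].

Definition denom3 (d1 d2 d3 : nat) : {poly rat} :=
  (1 - 'X^d1) * (1 - 'X^d2) * (1 - 'X^d3).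

(* The coefficient of t^n in P(t) H(S; t), where H(S; t) = \sum_(s in S) t^s
   as a formal power series. *)
Definition mul_hilbert_coef (P : {poly rat}) (S : pred nat) (n : nat) : rat :=
  \sum_(i < n.+1) P`_i * (S (n - i)%N)%:R.

(* H(S3; t) = Q(t) / ((1 - t^d1) (1 - t^d2) (1 - t^d3)); this determines Q. *)
Definition is_hilbert_numerator (d1 d2 d3 : nat) (Q : {poly rat}) : Prop :=
  forall n : nat,
    Q`_n = mul_hilbert_coef (denom3 d1 d2 d3) (semigroup3 d1 d2 d3) n.

Definition power_moment (Q : {poly rat}) (k : nat) : rat :=
  \sum_(j < size Q) Q`_j * (j : nat)%:R ^+ k.

(* The solution K_r of ((r+3)! / r!) K_r d1 d2 d3 = \sum_j c_j j^(r+3), for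
   Q = \sum_j c_j t^j; when Q is written with the degrees of syzygies, the
   right-hand side is the usual power sum, by power_moment_syzygies. *)
Definition genusK (d1 d2 d3 : nat) (Q : {poly rat}) (r : nat) : rat :=
  power_moment Q (r + 3)%N
    / (((r + 3)`!)%:R / (r`!)%:R * (d1 * d2 * d3)%N%:R).

Lemma semigroup3P d1 d2 d3 n :
  reflect (exists a b c : nat, n = (a * d1 + b * d2 + c * d3)%N)
          (semigroup3 d1 d2 d3 n).
Proof.
apply: (iffP existsP) => [[a /existsP[b /existsP[c /eqP e]]]|].
  by exists a, b, c.
have small (m d : nat) : exists2 m' : nat,
    (m' * d = m * d)%N & (m' <= m * d)%N.
  case: d => [|d]; first by exists 0%N; rewrite ?muln0.
  by exists m => //; rewrite leq_pmulr.
move=> [a [b [c e]]].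
have [a' ea la] := small a d1; have [b' eb lb] := small b d2.
have [c' ec lc] := small c d3.
have ha : (a' < n.+1)%N by lia.
have hb : (b' < n.+1)%N by lia.
have hc : (c' < n.+1)%N by lia.
exists (Ordinal ha); apply/existsP; exists (Ordinal hb); apply/existsP.
by exists (Ordinal hc); rewrite /= ea eb ec {1}e.
Qed.

Lemma is_frobenius_uniq S F F' :
  is_frobenius S F -> is_frobenius S F' -> F = F'.
Proof.
move=> [_ nF gF] [_ nF' gF']; case: (ltngtP F F') => // h.
  by rewrite gF in nF'.
by rewrite gF' in nF.
Qed.

Lemma is_frobenius_exists d1 d2 d3 :
  gcdn (gcdn d1 d2) d3 = 1%N -> (1 < d1)%N -> (1 < d2)%N -> (1 < d3)%N ->
  exists F, is_frobenius (semigroup3 d1 d2 d3) F.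
Proof.
move=> cop h1 h2 h3; set S := semigroup3 d1 d2 d3.
have [u v e1 _] := egcdnP d2 (ltnW h1).
have g0 : (0 < gcdn d1 d2)%N by rewrite gcdn_gt0 (ltnW h1).
have [w z e2 _] := egcdnP d3 g0; rewrite cop in e2.
pose m := (w * v * d2 + z * d3)%N.
have em : m.+1 = (w * u * d1)%N.
  by rewrite -mulnA e1 mulnDr e2 /m mulnA addnA addn1.
have big n : (m * m <= n)%N -> S n.
  move=> hn; pose q := (n %/ m.+1)%N; apply/semigroup3P.
  case: (posnP m) => [m0|m0].
    exists (n * (w * u))%N, 0%N, 0%N.
    by rewrite -mulnA -em m0 muln1 !mul0n !addn0.
  have en := divn_eq n m; set qq := (n %/ m)%N in en.
  have lr : (n %% m < m)%N by rewrite ltn_mod.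
  set r := (n %% m)%N in en lr.
  have lq : (m <= qq)%N by rewrite leq_divRL.
  exists (r * (w * u))%N, ((qq - r) * (w * v))%N, ((qq - r) * z)%N.
  rewrite -[(r * _ * d1)%N]mulnA -em -addnA -!mulnA -mulnDr mulnA -/m.
  rewrite en -{1}(subnK (_ : r <= qq)%N); first by rewrite mulnDl mulnS; lia.
  exact: leq_trans (ltnW lr) lq.
have n1 : ~~ S 1%N.
  apply/negP => /semigroup3P [a [b [c]]].
  by case: a => [|a]; case: b => [|b]; case: c => [|c]; nia.
have bnd i : ~~ S i -> (i <= m * m)%N.
  by move=> nS; rewrite leqNgt; apply/negP => /ltnW /big; apply/negP.
have exS : exists i, ~~ S i by exists 1%N.
case: (ex_maxnP exS bnd) => F nF maxF; exists F; split => //.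
  exact: maxF n1.
by move=> n lt; apply: contraLR lt => /maxF; rewrite -leqNgt.
Qed.

Lemma is_hilbert_numerator_uniq d1 d2 d3 Q Q' :
  is_hilbert_numerator d1 d2 d3 Q -> is_hilbert_numerator d1 d2 d3 Q' -> Q = Q'.
Proof. by move=> hQ hQ'; apply/polyP => i; rewrite hQ hQ'. Qed.

Lemma is_hilbert_numerator_exists d1 d2 d3 F :
  is_frobenius (semigroup3 d1 d2 d3) F ->
  exists Q, is_hilbert_numerator d1 d2 d3 Q.
Proof.
move=> [_ _ gF]; set S := semigroup3 d1 d2 d3 in gF *.
pose P := denom3 d1 d2 d3; pose g := (F + (d1 + d2 + d3))%N.
exists (\poly_(n < g.+1) mul_hilbert_coef P S n) => n.
rewrite coef_poly ltnS; case: leqP => // ltn.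
have s1 d : (size (1 - 'X^d : {poly rat})%R <= d.+1)%N.
  by rewrite (leq_trans (size_polyD _ _)) // size_polyN size_polyXn size_poly1
             geq_max /=.
have sP : (size P <= (d1 + d2 + d3).+1)%N.
  have sM (p q : {poly rat}) m n' : (size p <= m.+1)%N -> (size q <= n'.+1)%N ->
      (size (p * q)%R <= (m + n').+1)%N.
    move=> hp hq; apply: leq_trans (size_polyMleq p q) _.
    by have := leq_add hp hq; case: (_ + _)%N => [|t] //=; lia.
  exact: sM (sM _ _ _ _ (s1 d1) (s1 d2)) (s1 d3).
have sPn : (size P <= n.+1)%N by apply: leq_trans sP _; rewrite /g in ltn; lia.
have P1 : P.[1] = 0 by rewrite /P /denom3 !hornerE !expr1n subrr !mul0r.
rewrite -[LHS]P1 (horner_coef_wide _ sPn); apply: eq_bigr => i _.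
rewrite expr1n; case: (ltnP i (size P)) => hi; last first.
  by rewrite (nth_default _ hi) !mul0r.
by rewrite -/P -/S gF //; rewrite /g in ltn; lia.
Qed.

Lemma power_moment_wide (Q : {poly rat}) k N : (size Q <= N)%N ->
  power_moment Q k = \sum_(j < N) Q`_j * (j : nat)%:R ^+ k.
Proof.
move=> le; rewrite /power_moment (big_ord_widen _ (fun j => Q`_j * j%:R ^+ k) le).
rewrite big_mkcond; apply: eq_bigr => i _; case: ltnP => // h.
by rewrite (nth_default _ h) mul0r.
Qed.

Lemma power_moment_syzygies x1 x2 x3 y g k : (0 < k)%N ->
  power_moment (1 - 'X^x1 - 'X^x2 - 'X^x3 + 'X^y + 'X^g) k =
  (y%:R ^+ k + g%:R ^+ k) - (x1%:R ^+ k + x2%:R ^+ k + x3%:R ^+ k).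
Proof.
move=> k0; set Q := (X in power_moment X).
pose N := (size Q + (x1 + x2 + x3 + y + g)).+1.
have mX m : (m < N)%N ->
    \sum_(j < N) ('X^m : {poly rat})`_j * (j : nat)%:R ^+ k = m%:R ^+ k.
  move=> lt; rewrite (bigD1 (Ordinal lt)) //= coefXn eqxx mul1r big1 ?addr0 //.
  by move=> j; rewrite -val_eqE coefXn /= => /negbTE->; rewrite mul0r.
have lt m : (m <= x1 + x2 + x3 + y + g)%N -> (m < N)%N.
  by move=> h; rewrite ltnS (leq_trans h) ?leq_addl.
have X0 : \sum_(j < N) (1 : {poly rat})`_j * (j : nat)%:R ^+ k = 0 :> rat.
  by rewrite -[1]/('X^0 : {poly rat}) mX ?lt // expr0n eqn0Ngt k0.
rewrite (@power_moment_wide _ _ N); last by rewrite leqW ?leq_addr.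
under eq_bigr => j _ do rewrite !coefD !coefN !mulrDl !mulNr.
by rewrite !big_split /= !sumrN X0 !mX; try (apply: lt; lia); ring.
Qed.

(* Main.v *)
Require Import Defs.
From mathcomp Require Import all_boot all_order all_algebra.
From mathcomp Require Import ring lra zify.
Import Order.TTheory GRing.Theory Num.Theory.

(** Every residue class mod d1 has a least element in the semigroup; these d1
    elements form the Apery set, and they are combinations j d2 + k d3.  With
    one pair (j, k) suitably chosen for each, the pairs fill an L-shape, the
    union of the rectangles A x b and a x B with a <= A and b <= B
    ([L_shape_of_representatives]).  The numerator of the Hilbert series is
    (1 - t^d2) (1 - t^d3) times the generating function of the Apery set, and
    over an L-shape this product telescopes to
      1 - t^x1 - t^x2 - t^x3 + t^y + t^g,
    where x1 = A d2, x2 = B d3, x3 = a d2 + b d3, and g >= y are the values of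
    j d2 + k d3 at the outer corners (A, b) and (a, B); the larger one, g, is
    the Frobenius number plus d1 + d2 + d3 ([L_poly_numerator],
    [frobenius_L_shape]).

    Counting the L-shape gives Ab + aB - ab = d1, that is, with P = d1 d2 d3,
      x1 + x2 + x3 = g + y  and  x1^2 + x2^2 + x3^2 + 2 P = g^2 + y^2,
    and every x_i is at most y.  These relations alone imply
      3 P g^4 <= g^6 + y^6 - x1^6 - x2^6 - x3^6 <= (26/3) P g^4
    ([sixth_moment_bounds]).  The middle term is 120 P K_3, so the rescaled
    genus lies between 1/40 = 0.025 and 13/180 = 0.0722... *)

(** * The Apery set and its encoding by pairs *)

(** The elements of the Apery set of d1: those n in the semigroup for which
    n - d1 is not in it, the least elements of their residue classes. *)
Definition apery (d1 d2 d3 n : nat) : bool :=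
  semigroup3 d1 d2 d3 n && ~~ ((d1 <= n) && semigroup3 d1 d2 d3 (n - d1)).

(** An Apery element can be written j d2 + k d3 in several ways; these differ by
    multiples of lcm(d2, d3), so the bound on j selects exactly one of them. *)
Definition apery_code (d1 d2 d3 j k : nat) : bool :=
  (j * d2 < lcmn d2 d3) && apery d1 d2 d3 (j * d2 + k * d3).

Lemma semigroup3D d1 d2 d3 m n a b c :
  semigroup3 d1 d2 d3 m -> n = m + (a * d1 + b * d2 + c * d3) ->
  semigroup3 d1 d2 d3 n.
Proof.
move=> /semigroup3P [a' [b' [c' ->]]] ->; apply/semigroup3P.
by exists (a' + a), (b' + b), (c' + c); ring.
Qed.

Lemma aperyP d1 d2 d3 w : apery d1 d2 d3 w ->
  exists j k, w = j * d2 + k * d3.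
Proof.
move=> /andP [/semigroup3P [[|a] [j [k ->]]]]; first by exists j, k.
case/negP; apply/andP; split; first by lia.
by apply/semigroup3P; exists a, j, k; lia.
Qed.

Lemma apery_inj d1 d2 d3 v w : apery d1 d2 d3 v -> apery d1 d2 d3 w ->
  v = w %[mod d1] -> v = w.
Proof.
wlog le_vw : v w / v <= w => [hw|].
  case: (leqP v w) => [|/ltnW] le hv hw' e; first exact: hw.
  by apply/esym/hw.
move=> /andP [Sv _] /andP [_ nSw] /eqP; rewrite eq_sym eqn_mod_dvd //.
case/dvdnP => [[|q] e]; first by lia.
case/negP: nSw; apply/andP; split; first by lia.
by apply: (semigroup3D _ _ _ _ _ q 0 0 Sv); lia.
Qed.

Lemma apery_exists d1 d2 d3 n : semigroup3 d1 d2 d3 n -> 0 < d1 ->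
  exists w, [/\ apery d1 d2 d3 w, w <= n & w = n %[mod d1]].
Proof.
move=> + d1_gt0; have [m] := ubnP n; elim: m n => // m IH n lt_nm Sn.
case ap: (apery d1 d2 d3 n); first by exists n.
move: ap; rewrite /apery Sn /= => /negbFE /andP [le_d1n Sn'].
have [|w [apw le_w e]] := IH (n - d1) _ Sn'; first by lia.
exists w; split => //; first by lia.
by rewrite e -[in RHS](subnK le_d1n) modnDr.
Qed.

Lemma apery_code_down d1 d2 d3 j k j' k' : j' <= j -> k' <= k ->
  apery_code d1 d2 d3 j k -> apery_code d1 d2 d3 j' k'.
Proof.
move=> le_j le_k /andP [lt_j /andP [_ nS]].
apply/andP; split; first by apply: leq_ltn_trans lt_j; rewrite leq_mul.
apply/andP; split; first by apply/semigroup3P; exists 0, j', k'.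
apply: contra nS => /andP [le_d1 S]; apply/andP; split.
  by apply: leq_trans le_d1 _; rewrite leq_add // leq_mul.
apply: (semigroup3D _ _ _ _ _ 0 (j - j') (k - k') S).
rewrite !mulnBl; have := leq_mul le_j (leqnn d2).
by have := leq_mul le_k (leqnn d3); lia.
Qed.

Lemma apery_code_inj d1 d2 d3 j k j' k' : 0 < d2 -> 0 < d3 ->
  apery_code d1 d2 d3 j k -> apery_code d1 d2 d3 j' k' ->
  j * d2 + k * d3 = j' * d2 + k' * d3 %[mod d1] -> j = j' /\ k = k'.
Proof.
move=> d2_gt0 d3_gt0 /andP [lt_j ap] /andP [lt_j' ap'].
move=> /(apery_inj _ _ _ _ _ ap ap') {ap ap'}; wlog le_j : j k j' k' lt_j lt_j' / j <= j' => [hw|] e.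
  case: (leqP j j') => [|/ltnW] le; first exact: hw.
  by have [] := hw j' k' j k lt_j' lt_j le (esym e).
suff ej : j = j'.
  split=> //; move/eqP: e; rewrite ej eqn_add2l eqn_pmul2r //; exact/eqP.
have le_k : k' <= k.
  by rewrite -(leq_pmul2r d3_gt0); have := leq_mul le_j (leqnn d2); lia.
have dv : d3 %| (j' - j) * d2.
  apply/dvdnP; exists (k - k'); rewrite !mulnBl.
  by have := leq_mul le_j (leqnn d2); have := leq_mul le_k (leqnn d3); lia.
have : lcmn d2 d3 %| (j' - j) * d2 by rewrite dvdn_lcm dvdn_mull.
case: (posnP (j' - j)) => [|p]; first by lia.
have p2 : 0 < (j' - j) * d2 by rewrite muln_gt0 p.
by move/(dvdn_leq p2); rewrite mulnBl; lia.
Qed.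

Lemma apery_codeP d1 d2 d3 w : 0 < d2 -> 0 < d3 -> apery d1 d2 d3 w ->
  exists j k, apery_code d1 d2 d3 j k /\ w = j * d2 + k * d3.
Proof.
move=> d2_gt0 d3_gt0 ap; have [j [k e]] := aperyP _ _ _ _ ap.
have /dvdnP [p ep] := dvdn_lcml d2 d3; have /dvdnP [q eq] := dvdn_lcmr d2 d3.
have p_gt0 : 0 < p.
  have : 0 < lcmn d2 d3 by rewrite lcmn_gt0 d2_gt0.
  by rewrite ep muln_gt0 => /andP [].
have e' : w = (j %% p) * d2 + (j %/ p * q + k) * d3.
  by rewrite e {1}(divn_eq j p) !mulnDl -!mulnA -ep eq; lia.
exists (j %% p), (j %/ p * q + k); split=> //.
by rewrite /apery_code -e' ap andbT ep ltn_pmul2r // ltn_mod.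
Qed.

(** * The L-shape *)

Definition L_shape (A B a b j k : nat) : bool :=
  (j < A) && (k < b) || (j < a) && (k < B).

(** Call two pairs congruent when their values j d2 + k d3 agree mod d1.  Each
    pair is congruent to a unique pair of I.  Shifting this congruence by a unit
    vector shows that a minimal point of the complement of I, off the axes, is
    congruent to the origin.  Two such points would make a point of one axis
    congruent to a point of the other, both in I; so there is at most one inner
    corner (a, b), and I is an L-shape.  The last two inequalities compare
    (A, 0) and (0, B) with their representatives, which lie on the other axis at
    distance at least B - b and A - a from the origin.  When I is a rectangle,
    a = A and b = B. *)
Lemma L_shape_of_representatives d1 d2 d3 (I : nat -> nat -> bool) :
  0 < d1 ->
  (forall j k j' k', j' <= j -> k' <= k -> I j k -> I j' k') ->
  (forall j k j' k', I j k -> I j' k' ->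
     j * d2 + k * d3 = j' * d2 + k' * d3 %[mod d1] -> j = j' /\ k = k') ->
  (forall j k, exists j' k', [/\ I j' k',
     j' * d2 + k' * d3 <= j * d2 + k * d3 &
     j' * d2 + k' * d3 = j * d2 + k * d3 %[mod d1]]) ->
  exists A B a b,
    [/\ 0 < a <= A, 0 < b <= B, I =2 L_shape A B a b,
        A * d2 <= a * d2 + B * d3 & B * d3 <= A * d2 + b * d3].
Proof.
move=> d1_gt0 down inj rep.
have I00 : I 0 0 by have [j [k [Ijk _ _]]] := rep 0 0; apply: down Ijk.
have outj : exists j, ~~ I j 0.
  exists d1; apply/negP => /inj /(_ I00).
  by rewrite addn0 modnMr mod0n => /(_ erefl) [?]; lia.
have outk : exists k, ~~ I 0 k.
  exists d1; apply/negP => /inj /(_ I00).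
  by rewrite add0n modnMr mod0n => /(_ erefl) [_ ?]; lia.
case: (ex_minnP outj) => A nIA minA; case: (ex_minnP outk) => B nIB minB.
have A_gt0 : 0 < A by case: (A) nIA; rewrite ?I00.
have B_gt0 : 0 < B by case: (B) nIB; rewrite ?I00.
have IltA j : j < A -> I j 0.
  by move=> lt; apply: contraLR lt => /minA; rewrite -leqNgt.
have IltB k : k < B -> I 0 k.
  by move=> lt; apply: contraLR lt => /minB; rewrite -leqNgt.
have leA j k : I j k -> j < A.
  by move=> Ijk; rewrite ltnNge; apply: contra nIA => le; apply: down Ijk.
have leB j k : I j k -> k < B.
  by move=> Ijk; rewrite ltnNge; apply: contra nIB => le; apply: down Ijk.
have inj2 j k j' k' : I j k -> I j' k' ->
    j.+1 * d2 + k * d3 = j'.+1 * d2 + k' * d3 %[mod d1] -> j = j' /\ k = k'.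
  move=> Ijk Ijk' /eqP e; apply: inj => //; apply/eqP; move: e.
  by rewrite !mulSn -!addnA eqn_modDl.
have inj3 j k j' k' : I j k -> I j' k' ->
    j * d2 + k.+1 * d3 = j' * d2 + k'.+1 * d3 %[mod d1] -> j = j' /\ k = k'.
  move=> Ijk Ijk' /eqP e; apply: inj => //; apply/eqP; move: e.
  by rewrite !mulSn (addnCA (j * d2)) (addnCA (j' * d2)) eqn_modDl.
(* the point outside I next to the axis is represented on the other axis *)
have repA : exists2 k, I 0 k & k * d3 <= A * d2 /\ k * d3 = A * d2 %[mod d1].
  have [[|j] [k [Ijk le e]]] := rep A 0.
    by exists k => //; move: le e; rewrite mul0n add0n addn0.
  case: (A) A_gt0 nIA IltA e {le leA minA} => // A' _ nIA IltA /inj2 [].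
  - exact: down Ijk.
  - exact: IltA.
  by move=> ej ek; rewrite ej ek in Ijk; rewrite Ijk in nIA.
have repB : exists2 j, I j 0 & j * d2 <= B * d3 /\ j * d2 = B * d3 %[mod d1].
  have [j [[|k] [Ijk le e]]] := rep 0 B.
    by exists j => //; move: le e; rewrite mul0n add0n addn0.
  case: (B) B_gt0 nIB IltB e {le leB minB} => // B' _ nIB IltB /inj3 [].
  - exact: down Ijk.
  - exact: IltB.
  by move=> ej ek; rewrite ej ek in Ijk; rewrite Ijk in nIB.
(* a point outside I whose lower neighbours are in I is represented by 0 *)
have corner j k : ~~ I j.+1 k.+1 -> I j k.+1 -> I j.+1 k ->
    j.+1 * d2 + k.+1 * d3 = 0 %[mod d1].
  move=> nI Ij Ik; have [j' [k' [I' _ e]]] := rep j.+1 k.+1.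
  case: j' I' e => [|j'] I' e.
    case: k' I' e => [|k'] I' e; first by rewrite -e.
    by have [|//] := inj3 _ _ _ _ _ Ik e; apply: down I'.
  have [|ej ek] := inj2 _ _ _ _ _ Ij e; first exact: down I'.
  by rewrite ej ek in I'; rewrite I' in nI.
case: (boolP [forall j : 'I_A, [forall k : 'I_B, I j k]]) => [full|].
  exists A, B, A, B; rewrite A_gt0 B_gt0 !leqnn; split; try by lia.
  move=> j k; rewrite /L_shape orbb; apply/idP/andP => [Ijk|[lj lk]].
    by split; [exact: leA Ijk|exact: leB Ijk].
  by move/forallP/(_ (Ordinal lj))/forallP/(_ (Ordinal lk)): full.
(* the inner corner: the first column not filled up to B, and its height *)
rewrite negb_forall => /existsP [j0]; rewrite negb_forall => /existsP [k0 nI0].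
have outa : exists a, ~~ I a B.-1.
  by exists j0; apply: contra nI0; apply: down => //; have := ltn_ord k0; lia.
case: (ex_minnP outa) => a nIa mina.
have Ilta j k : j < a -> k < B -> I j k.
  move=> lt ltk; suff : I j B.-1 by apply: down => //; lia.
  by apply: contraLR lt => /mina; rewrite -leqNgt.
have a_gt0 : 0 < a.
  by case: (a) nIa => //; rewrite IltB //; lia.
have lt_aA : a < A.
  apply: leq_ltn_trans (mina j0 _) (ltn_ord j0).
  by apply: contra nI0; apply: down => //; have := ltn_ord k0; lia.
have outb : exists b, ~~ I a b by exists B.-1.
case: (ex_minnP outb) => b nIb minb.
have Iltb k : k < b -> I a k.
  by move=> lt; apply: contraLR lt => /minb; rewrite -leqNgt.
have b_gt0 : 0 < b by case: (b) nIb => //; rewrite IltA.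
have lt_bB : b < B by have := minb _ nIa; lia.
have eab : a * d2 + b * d3 = 0 %[mod d1].
  case: (a) (b) a_gt0 b_gt0 nIb lt_bB Ilta Iltb =>
    // a' [] // b' _ _ nI ltb Ia Ib.
  by apply: corner => //; [exact: Ia|exact: Ib].
(* a second such point would differ from (a, b) by a relation between points
   of the two axes *)
have ILb j k : j < A -> k < b -> I j k.
  move=> ltj ltk; apply: contraT => nI.
  have outk2 : exists k', ~~ I j k' by exists k.
  case: (ex_minnP outk2) => k2 nIk2 mink2.
  have le_k2 := mink2 _ nI.
  have outj2 : exists j', ~~ I j' k2 by exists j.
  case: (ex_minnP outj2) => j2 nIj2 minj2.
  have le_j2 := minj2 _ nIk2.
  have k2_gt0 : 0 < k2 by case: (k2) nIk2 => //; rewrite IltA.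
  have lt_a : a < j2.
    rewrite ltnNge; apply: contra nIj2 => le.
    by apply: down (Iltb k2 _) => //; exact: leq_ltn_trans ltk.
  have e2 : j2 * d2 + k2 * d3 = 0 %[mod d1].
    case: (j2) (k2) lt_a k2_gt0 nIj2 minj2 mink2 le_j2 {le_k2 nIk2} =>
      // j' [] // k' _ _ nI' mj mk le.
    apply: corner => //; first by apply: contraT => /mj; rewrite ltnn.
    by apply: (@down j k') => //; apply: contraT => /mk; rewrite ltnn.
  have lt_k2b : k2 < b by exact: leq_ltn_trans ltk.
  have [p ep] : exists p, j2 = a + p by exists (j2 - a); rewrite subnKC // ltnW.
  have [q eb] : exists q, b = k2 + q by exists (b - k2); rewrite subnKC // ltnW.
  have Ip : I p 0.
    by apply/IltA/(leq_ltn_trans _ ltj)/(leq_trans _ le_j2); rewrite ep leq_addl.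
  have Iq : I 0 q by apply/IltB/(leq_ltn_trans _ lt_bB); rewrite eb leq_addl.
  have [|p0 _] := inj _ _ _ _ Ip Iq; last by rewrite ep p0 addn0 ltnn in lt_a.
  apply/eqP; rewrite mul0n add0n addn0 -(eqn_modDl (a * d2 + k2 * d3)).
  by rewrite addnAC -mulnDl -ep -addnA -mulnDl -eb e2 eab.
exists A, B, a, b; rewrite a_gt0 b_gt0 (ltnW lt_aA) (ltnW lt_bB); split=> //.
- move=> j k; rewrite /L_shape; apply/idP/orP => [Ijk|].
    have ltA := leA _ _ Ijk; have ltB := leB _ _ Ijk.
    rewrite ltA ltB andbT /=; case: (ltnP j a) => lja; [by right|left].
    by rewrite ltnNge; apply: contra nIb => le; apply: down Ijk.
  by case=> /andP [lj lk]; [apply: ILb|apply: Ilta].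
- have [j Ij [le e]] := repB; suff lej : A <= a + j.
    by apply: leq_trans (leq_mul lej (leqnn d2)) _; rewrite mulnDl leq_add2l.
  rewrite leqNgt; apply/negP => lt.
  have [q eB] : exists q, B = b + q by exists (B - b); rewrite subnKC // ltnW.
  have Iq : I 0 q by apply: IltB; rewrite eB -[q in q < _]add0n ltn_add2r.
  have [|/eqP] := inj _ _ _ _ (IltA _ lt) Iq; last by rewrite addn_eq0 gtn_eqF.
  apply/eqP; rewrite mul0n add0n addn0 -(eqn_modDl (b * d3)) -mulnDl -eB.
  by rewrite addnC mulnDl addnAC -modnDml eab mod0n add0n e.
- have [k Ik [le e]] := repA; suff lek : B <= b + k.
    apply: leq_trans (leq_mul lek (leqnn d3)) _.
    by rewrite mulnDl addnC leq_add2r.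
  rewrite leqNgt; apply/negP => lt.
  have [p ep] : exists p, A = a + p by exists (A - a); rewrite subnKC // ltnW.
  have Ip : I p 0 by apply: IltA; rewrite ep -[p in p < _]add0n ltn_add2r.
  have [|_ /esym/eqP] := inj _ _ _ _ Ip (IltB _ lt);
    last by rewrite addn_eq0 gtn_eqF.
  apply/eqP; rewrite mul0n add0n addn0 -(eqn_modDl (a * d2)) -mulnDl -ep.
  by rewrite mulnDl addnA -[X in _ == X]modnDml eab mod0n add0n e.
Qed.

Local Open Scope ring_scope.

Lemma apery_code_L_shape d1 d2 d3 : (0 < d1)%N -> (0 < d2)%N -> (0 < d3)%N ->
  exists A B a b : nat,
    [/\ (0 < a <= A)%N, (0 < b <= B)%N, apery_code d1 d2 d3 =2 L_shape A B a b,
        (A * d2 <= a * d2 + B * d3)%N & (B * d3 <= A * d2 + b * d3)%N].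
Proof.
move=> d1_gt0 d2_gt0 d3_gt0; apply: (L_shape_of_representatives d1) => //.
- exact: apery_code_down.
- by move=> *; apply: (apery_code_inj d1 d2 d3).
move=> j k.
have Sjk : semigroup3 d1 d2 d3 (j * d2 + k * d3).
  by apply/semigroup3P; exists 0%N, j, k.
have [w [ap le e]] := apery_exists _ _ _ _ Sjk d1_gt0.
have [j' [k' [I' ew]]] := apery_codeP _ _ _ _ d2_gt0 d3_gt0 ap.
by exists j', k'; rewrite -ew.
Qed.

Lemma apery_frobenius d1 d2 d3 F : is_frobenius (semigroup3 d1 d2 d3) F ->
  (0 < d1)%N ->
  apery d1 d2 d3 (F + d1) /\ (forall w, apery d1 d2 d3 w -> (w <= F + d1)%N).
Proof.
move=> [_ nF gF] d1_gt0; split.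
  by rewrite /apery addnK (negbTE nF) andbF gF //; lia.
move=> w /andP [_]; apply: contraR; rewrite -ltnNge => lt.
by rewrite gF; lia.
Qed.

(** F + d1 is the largest Apery element, hence attained at one of the two outer
    corner cells of the L-shape; adding d2 + d3 moves to the corner itself. *)
Lemma frobenius_L_shape d1 d2 d3 F A B a b :
  (0 < d1)%N -> (0 < d2)%N -> (0 < d3)%N ->
  is_frobenius (semigroup3 d1 d2 d3) F ->
  (0 < a <= A)%N -> (0 < b <= B)%N -> apery_code d1 d2 d3 =2 L_shape A B a b ->
  (F + d1 + d2 + d3)%N = maxn (A * d2 + b * d3) (a * d2 + B * d3).
Proof.
move=> d1_gt0 d2_gt0 d3_gt0 hF /andP [a_gt0 le_aA] /andP [b_gt0 le_bB] IE.
have [apF maxF] := apery_frobenius _ _ _ _ hF d1_gt0.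
have corner j k : (0 < j)%N -> (0 < k)%N -> L_shape A B a b j.-1 k.-1 ->
    (j * d2 + k * d3 <= F + d1 + d2 + d3)%N.
  case: j k => [|j] [|k] // _ _; rewrite -IE => /andP [_ /maxF].
  by rewrite /= !mulSn; lia.
have A_gt0 := leq_trans a_gt0 le_aA; have B_gt0 := leq_trans b_gt0 le_bB.
apply/anti_leq/andP; split; last first.
  by rewrite geq_max !corner // /L_shape !prednK // !leqnn ?orbT.
have [j [k [+ ->]]] := apery_codeP _ _ _ _ d2_gt0 d3_gt0 apF.
rewrite IE leq_max => /orP [] /andP [lj lk]; apply/orP; [left|right];
  have := leq_mul lj (leqnn d2); have := leq_mul lk (leqnn d3);
  by rewrite !mulSn; lia.
Qed.

(** * The numerator of the Hilbert series *)

Lemma coefX1subM (R : nzRingType) (p : {poly R}) d n :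
  ((1 - 'X^d) * p)`_n = p`_n - (if (d <= n)%N then p`_(n - d)%N else 0).
Proof.
by rewrite mulrBl mul1r coefB coefXnM; case: ltnP.
Qed.

Lemma aperyE d1 d2 d3 n : (apery d1 d2 d3 n)%:R =
  (semigroup3 d1 d2 d3 n)%:R -
  (if (d1 <= n)%N then (semigroup3 d1 d2 d3 (n - d1)%N)%:R else 0) :> rat.
Proof.
rewrite /apery; case: leqP => le /=; last by rewrite andbT subr0.
case S1: (semigroup3 d1 d2 d3 (n - d1)%N) => /=; last by rewrite andbT subr0.
rewrite (semigroup3D _ _ _ _ n 1 0 0 S1) ?subrr //.
by rewrite mul1n !mul0n !addn0 subnK.
Qed.

(** Because (1 - t^d1) H(t) is the generating function of the Apery set. *)
Lemma hilbert_numerator_apery d1 d2 d3 (L : {poly rat}) :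
  (forall n, L`_n = (apery d1 d2 d3 n)%:R) ->
  is_hilbert_numerator d1 d2 d3 ((1 - 'X^d2) * (1 - 'X^d3) * L).
Proof.
move=> LE n; set S := semigroup3 d1 d2 d3.
pose H : {poly rat} := \poly_(i < n.+1) (S i)%:R.
have HE i : (i <= n)%N -> H`_i = (S i)%:R by rewrite coef_poly ltnS => ->.
transitivity ((denom3 d1 d2 d3 * H)`_n); last first.
  by rewrite coefM; apply: eq_bigr => i _; rewrite HE // leq_subr.
have -> : denom3 d1 d2 d3 * H = (1 - 'X^d2) * (1 - 'X^d3) * ((1 - 'X^d1) * H).
  by rewrite /denom3; ring.
rewrite !(coefM (_ * _)).
apply: eq_bigr => i _; congr (_ * _).
rewrite coefX1subM LE aperyE HE ?leq_subr //; case: ifP => // _.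
by rewrite HE // (leq_trans (leq_subr _ _)) ?leq_subr.
Qed.

(** The elements below M + d1 exceed those below M by d1 of them, and the partial
    sums of the Apery indicator telescope to this difference. *)
Lemma sum_apery d1 d2 d3 M : (forall n, (M <= n)%N -> semigroup3 d1 d2 d3 n) ->
  \sum_(n < M + d1) (apery d1 d2 d3 n)%:R = d1%:R :> rat.
Proof.
move=> SM; under eq_bigr do rewrite aperyE.
rewrite sumrB big_split_ord /= [in X in _ - X]addnC big_split_ord /=.
rewrite [X in _ - (X + _)]big1 => [|i _]; last by rewrite leqNgt ltn_ord.
under [X in _ - (_ + X)]eq_bigr do rewrite leq_addr addKn.
rewrite add0r addrC addrK; under eq_bigr do rewrite SM ?leq_addr //.
by rewrite sumr_const card_ord.
Qed.

Definition L_poly d2 d3 A B a b : {poly rat} :=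
  \sum_(j < A) \sum_(k < B)
    (if L_shape A B a b j k then 'X^(j * d2 + k * d3) else 0).

Lemma geometric_sum (R : nzRingType) d n :
  (1 - 'X^d) * (\sum_(i < n) 'X^(i * d)) = 1 - 'X^(n * d) :> {poly R}.
Proof.
elim: n => [|n IH]; first by rewrite big_ord0 mulr0 mul0n expr0 subrr.
rewrite big_ord_recr /= mulrDr IH mulrBl mul1r -exprD -mulSn.
by rewrite addrA subrK.
Qed.

(** The L-shape is the rectangle A x b together with what the rectangle a x B adds
    above height b. *)
Lemma L_polyE d2 d3 A B a b (G := fun d n => \sum_(i < n) 'X^(i * d)) :
  (a <= A)%N -> (b <= B)%N ->
  L_poly d2 d3 A B a b =
  G d2 A * G d3 b + G d2 a * (G d3 B - G d3 b) :> {poly rat}.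
Proof.
move=> le_aA le_bB; rewrite /L_poly /G.
have widen d m n : (m <= n)%N -> \sum_(i < m) 'X^(i * d) =
    \sum_(i < n) (if (i < m)%N then 'X^(i * d) else 0) :> {poly rat}.
  by move=> le; rewrite (big_ord_widen n (fun i => 'X^(i * d)) le) big_mkcond.
rewrite (widen d2 a A le_aA) (widen d3 b B le_bB).
rewrite !mulr_suml -big_split /=; apply: eq_bigr => j _.
rewrite -sumrB !mulr_sumr -big_split /=; apply: eq_bigr => k _.
rewrite /L_shape !ltn_ord andbT exprD /=.
by case: (k < b)%N; case: (j < a)%N => /=; ring.
Qed.

Lemma coef_L_poly d1 d2 d3 A B a b n :
  (0 < d2)%N -> (0 < d3)%N -> (a <= A)%N -> (b <= B)%N ->
  apery_code d1 d2 d3 =2 L_shape A B a b ->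
  (L_poly d2 d3 A B a b)`_n = (apery d1 d2 d3 n)%:R.
Proof.
move=> d2_gt0 d3_gt0 le_aA le_bB IE.
have -> : (L_poly d2 d3 A B a b)`_n = \sum_(j < A) \sum_(k < B)
    (apery_code d1 d2 d3 j k && (n == j * d2 + k * d3)%N)%:R.
  rewrite coef_sum; apply: eq_bigr => j _.
  rewrite coef_sum; apply: eq_bigr => k _.
  by rewrite IE; case: ifP => _; rewrite ?coefXn ?coef0.
case ap: (apery d1 d2 d3 n); last first.
  rewrite big1 // => j _; rewrite big1 // => k _.
  by case: andP => // -[/andP [_ +] /eqP e]; rewrite -e ap.
have [j0 [k0 [I0 e0]]] := apery_codeP _ _ _ _ d2_gt0 d3_gt0 ap.
have [lt_j lt_k] : (j0 < A)%N /\ (k0 < B)%N.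
  by move: I0; rewrite IE => /orP [] /andP [lj lk]; split=> //;
    [exact: leq_trans le_bB|exact: leq_trans le_aA].
have one (j k : nat) : apery_code d1 d2 d3 j k -> n = (j * d2 + k * d3)%N ->
    j = j0 /\ k = k0.
  move=> Ijk e; apply: (apery_code_inj d1 d2 d3) => //.
  by rewrite -e -e0.
rewrite (bigD1 (Ordinal lt_j)) //= (bigD1 (Ordinal lt_k)) //= I0 -e0 eqxx.
rewrite big1 ?big1 ?addr0 // => [j ne|k ne].
  rewrite big1 // => k _; case: andP => // -[Ijk /eqP e].
  by case/eqP: ne; apply: val_inj; have [] := one _ _ Ijk e.
case: andP => // -[Ijk /eqP e].
by case/eqP: ne; apply: val_inj; have [] := one _ _ Ijk e.
Qed.

Lemma L_poly_numerator d2 d3 A B a b : (a <= A)%N -> (b <= B)%N ->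
  (1 - 'X^d2) * (1 - 'X^d3) * L_poly d2 d3 A B a b =
  1 - 'X^(A * d2) - 'X^(B * d3) - 'X^(a * d2 + b * d3)
  + 'X^(A * d2 + b * d3) + 'X^(a * d2 + B * d3).
Proof.
move=> le_aA le_bB; rewrite L_polyE //.
set x := 1 - 'X^d2; set z := 1 - 'X^d3.
rewrite mulrDr !(mulrACA x z) !mulrBr !geometric_sum !exprD; ring.
Qed.

(** Both sides count the Apery set: evaluate its generating function at 1. *)
Lemma L_shape_area d1 d2 d3 A B a b M :
  (0 < d2)%N -> (0 < d3)%N -> (a <= A)%N -> (b <= B)%N ->
  apery_code d1 d2 d3 =2 L_shape A B a b ->
  (forall n, (M <= n)%N -> semigroup3 d1 d2 d3 n) ->
  (A%:R * b%:R + a%:R * B%:R - a%:R * b%:R) = d1%:R :> rat.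
Proof.
move=> d2_gt0 d3_gt0 le_aA le_bB IE SM.
pose L := L_poly d2 d3 A B a b.
have <- : L.[1] = d1%:R.
  rewrite (@horner_coef_wide _ (M + size L + d1)); last by lia.
  rewrite -[RHS](sum_apery d1 d2 d3 (M + size L)).
    apply: eq_bigr => n _.
    by rewrite expr1n mulr1 (coef_L_poly d1).
  by move=> n le; apply: SM; lia.
have G1 d n : (\sum_(i < n) 'X^(i * d) : {poly rat}).[1] = n%:R.
  rewrite horner_sum; under eq_bigr do rewrite hornerXn expr1n.
  by rewrite sumr_const card_ord.
rewrite /L L_polyE // !(hornerE, G1) /=; ring.
Qed.

(** * Bounds for the sixth moment *)

(** Write x_i = y - u_i.  The x_i and the triple (g, y, 0) have the same first
    elementary symmetric function, the second ones are g y + P and g y, and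
    x1 x2 x3 = y P - e; Newton's formula for the sixth power sum then gives an
    expression in g, y, P, e.  Its value at e = 0 does not involve y. *)
Lemma sixth_moment_deviations {R : comNzRingType} (y s u1 u2 u3 : R)
  (g := y + s) (P := u1 * u2 + u1 * u3 + u2 * u3 + s * y) (e := u1 * u2 * u3) :
  u1 + u2 + u3 + s = y ->
  g ^+ 6 + y ^+ 6 - ((y - u1) ^+ 6 + (y - u2) ^+ 6 + (y - u3) ^+ 6) =
  P * (6 * g ^+ 4 - 9 * g ^+ 2 * P + 2 * P ^+ 2)
  + 3 * e * (2 * ((g + y) * (g ^+ 2 + y ^+ 2) - (2 * g + y) * P) - e).
Proof. by rewrite /g /P /e => <-; ring. Qed.

(** In the identity above, 3 P <= g^2 bounds the main term between 3 P g^4 and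
    6 P g^4, and since e <= y^3 and 9 e <= g P the correction lies between 0 and
    (8/3) P g^4. *)
Lemma sixth_moment_bounds (R : realFieldType) (g y x1 x2 x3 P : R) :
  x1 + x2 + x3 = g + y ->
  x1 ^+ 2 + x2 ^+ 2 + x3 ^+ 2 + 2 * P = g ^+ 2 + y ^+ 2 ->
  x1 <= y -> x2 <= y -> x3 <= y -> y <= g ->
  3 * (P * g ^+ 4) <=
  g ^+ 6 + y ^+ 6 - (x1 ^+ 6 + x2 ^+ 6 + x3 ^+ 6) <= 26 / 3 * (P * g ^+ 4).
Proof.
move=> sum1 sum2 le1 le2 le3 leyg.
have [u1 u1E] : exists u, u = y - x1 by exists (y - x1).
have [u2 u2E] : exists u, u = y - x2 by exists (y - x2).
have [u3 u3E] : exists u, u = y - x3 by exists (y - x3).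
have [s sE] : exists s, s = g - y by exists (g - y).
have u1_ge0 : 0 <= u1 by lra.
have u2_ge0 : 0 <= u2 by lra.
have u3_ge0 : 0 <= u3 by lra.
have s_ge0 : 0 <= s by lra.
have yE : y = u1 + u2 + u3 + s by lra.
have gE : g = y + s by lra.
have x1E : x1 = y - u1 by lra.
have x2E : x2 = y - u2 by lra.
have x3E : x3 = y - u3 by lra.
have PE : P = u1 * u2 + u1 * u3 + u2 * u3 + s * y.
  apply: (@mulfI _ 2); first by rewrite pnatr_eq0.
  move: sum2; rewrite x1E x2E x3E gE yE => h.
  apply: (addrI ((u1 + u2 + u3 + s - u1) ^+ 2 + (u1 + u2 + u3 + s - u2) ^+ 2 +
    (u1 + u2 + u3 + s - u3) ^+ 2)).
  rewrite h; ring.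
rewrite x1E x2E x3E gE PE (sixth_moment_deviations _ _ _ _ _ (esym yE)) -gE -PE.
set e := u1 * u2 * u3.
have y_ge0 : 0 <= y by lra.
have g_ge0 : 0 <= g by lra.
have P_ge0 : 0 <= P by rewrite PE !addr_ge0 ?mulr_ge0.
have e_ge0 : 0 <= e by rewrite !mulr_ge0.
(* 2 g^2 - 6 P is the sum of the squares of the differences of the u_i, plus
   nonnegative terms in s *)
have le3P : 3 * P <= g ^+ 2.
  have h1 := sqr_ge0 (u1 - u2); have h2 := sqr_ge0 (u1 - u3).
  have h3 := sqr_ge0 (u2 - u3); have h4 := sqr_ge0 s.
  have h5 : 0 <= s * (u1 + u2 + u3) by rewrite mulr_ge0 ?addr_ge0.
  by rewrite PE gE yE; lra.
(* the inequality of arithmetic and geometric means for the u_i and for their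
   pairwise products, with three squares as certificate *)
have le9e : 9 * e <= g * P.
  rewrite gE PE yE /e.
  have h1 := mulr_ge0 u1_ge0 (sqr_ge0 (u2 - u3)).
  have h2 := mulr_ge0 u2_ge0 (sqr_ge0 (u1 - u3)).
  have h3 := mulr_ge0 u3_ge0 (sqr_ge0 (u1 - u2)).
  set q := u1 * u2 + u1 * u3 + u2 * u3.
  have q_ge0 : 0 <= q by rewrite !addr_ge0 ?mulr_ge0.
  set p := u1 + u2 + u3.
  have p_ge0 : 0 <= p by rewrite !addr_ge0.
  have h4 : 9 * (u1 * u2 * u3) <= p * q by rewrite /p /q; lra.
  apply: (le_trans h4); apply: ler_pM => //; first by rewrite /p; lra.
  by rewrite lerDl mulr_ge0 ?addr_ge0.
have le_e_y3 : e <= y ^+ 3.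
  have -> : y ^+ 3 = y * y * y by ring.
  by rewrite /e !ler_pM ?mulr_ge0 //; lra.
have gg_ge0 : 0 <= g ^+ 2 by apply: sqr_ge0.
have g4E : g ^+ 4 = g ^+ 2 * g ^+ 2 by rewrite -exprD.
have PP_ge0 : 0 <= P ^+ 2 by apply: sqr_ge0.
have legP : g * (3 * P) <= g * g ^+ 2 by apply: ler_wpM2l.
have legP2 : g ^+ 2 * (3 * P) <= g ^+ 2 * g ^+ 2 by apply: ler_wpM2l.
have legP1 : 0 <= g ^+ 2 * P by apply: mulr_ge0.
have hPP : P * (3 * P) <= P * g ^+ 2 by apply: ler_wpM2l.
have lo1 : 3 * g ^+ 4 <= 6 * g ^+ 4 - 9 * g ^+ 2 * P + 2 * P ^+ 2.
  by rewrite g4E; lra.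
have up1 : 6 * g ^+ 4 - 9 * g ^+ 2 * P + 2 * P ^+ 2 <= 6 * g ^+ 4.
  by rewrite g4E expr2; lra.
have ygg_ge0 : 0 <= y * g ^+ 2 by apply: mulr_ge0.
have gyy_ge0 : 0 <= g * y ^+ 2 by rewrite mulr_ge0 ?sqr_ge0.
have yy_le : y ^+ 2 <= g ^+ 2 by apply: lerXn2r.
have gyy_le : g * y ^+ 2 <= g * g ^+ 2 by apply: ler_wpM2l.
have yyy_le : y * y ^+ 2 <= g * g ^+ 2 by apply: ler_pM; rewrite ?sqr_ge0.
have ygg_le : y * g ^+ 2 <= g * g ^+ 2 by apply: ler_wpM2r.
have yP_le : y * P <= g * P by apply: ler_wpM2r.
set c := 2 * _ - e.
have lo2 : 0 <= c by rewrite /c; lra.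
have up2 : c <= 8 * g ^+ 3.
  have gP := mulr_ge0 g_ge0 P_ge0; have yP := mulr_ge0 y_ge0 P_ge0.
  rewrite /c (_ : g ^+ 3 = g * g ^+ 2) -?exprS //; lra.
have up3 : 3 * e * c <= 8 / 3 * (P * g ^+ 4).
  apply: (@le_trans _ _ (g * P / 3 * (8 * g ^+ 3))).
    by apply: ler_pM => //; rewrite ?mulr_ge0 //; lra.
  by rewrite le_eqVlt; apply/orP; left; apply/eqP; field.
have ll := ler_wpM2l P_ge0 lo1; have lu := ler_wpM2l P_ge0 up1.
have ec : 0 <= e * c by apply: mulr_ge0.
by apply/andP; split; lra.
Qed.

(** * The rescaled genus *)

Lemma rescaled_genus_bounds (R : realFieldType) (K M P g : R) :
  0 < P -> 0 < g -> K = M / (120 * P) ->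
  3 * (P * g ^+ 4) <= M <= 26 / 3 * (P * g ^+ 4) ->
  40^-1 <= K / g ^+ 4 <= 13 / 180.
Proof.
move=> P_gt0 g_gt0 -> /andP [lo hi].
have D_gt0 : 0 < P * g ^+ 4 by rewrite mulr_gt0 ?exprn_gt0.
have D120_gt0 : 0 < 120 * (P * g ^+ 4) by lra.
rewrite -mulrA -invfM -mulrA.
by rewrite ler_pdivlMr // ler_pdivrMr //; apply/andP; split; lra.
Qed.

Theorem mainTheorem5 (d1 d2 d3 : nat)
  (hgcd : gcdn (gcdn d1 d2) d3 = 1%N)
  (h1 : (3 <= d1)%N) (h12 : (d1 < d2)%N) (h23 : (d2 < d3)%N)
  (h3 : (d3 <= d1 * d2 - d1 - d2)%N)
  (hmin1 : ~ exists a b : nat, d1 = (a * d2 + b * d3)%N)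
  (hmin2 : ~ exists a b : nat, d2 = (a * d1 + b * d3)%N)
  (hmin3 : ~ exists a b : nat, d3 = (a * d1 + b * d2)%N)
  (F3 : nat) (hF : is_frobenius (semigroup3 d1 d2 d3) F3)
  (Q : {poly rat}) (hQ : is_hilbert_numerator d1 d2 d3 Q) :
  let g3 : rat := (F3 + d1 + d2 + d3)%N%:R in
  let h3 : rat := genusK d1 d2 d3 Q 3 / g3 ^+ 4 in
  2443%:R / 10%:R ^+ 5 < h3 < 7515%:R / 10%:R ^+ 5.
Proof.
have d1_gt0 : (0 < d1)%N by lia.
have d2_gt0 : (0 < d2)%N by lia.
have d3_gt0 : (0 < d3)%N by lia.
have [A [B [a [b [ha hb IE leA leB]]]]] :=
  apery_code_L_shape d1 d2 d3 d1_gt0 d2_gt0 d3_gt0.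
have gE := frobenius_L_shape _ _ _ _ _ _ _ _ d1_gt0 d2_gt0 d3_gt0 hF ha hb IE.
case/andP: ha => a_gt0 le_aA; case/andP: hb => b_gt0 le_bB.
have [_ _ gF] := hF.
have area :=
  L_shape_area d1 d2 d3 _ _ _ _ F3.+1 d2_gt0 d3_gt0 le_aA le_bB IE gF.
have coefL n := coef_L_poly d1 d2 d3 _ _ _ _ n d2_gt0 d3_gt0 le_aA le_bB IE.
have QE := is_hilbert_numerator_uniq hQ (hilbert_numerator_apery _ _ _ _ coefL).
rewrite (L_poly_numerator d2 d3 A B a b le_aA le_bB) in QE.
pose Ar : rat := (A * d2)%:R; pose Br : rat := (B * d3)%:R.
pose ar : rat := (a * d2)%:R; pose br : rat := (b * d3)%:R.
pose P : rat := (d1 * d2 * d3)%:R.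
have P_gt0 : 0 < P by rewrite ltr0n !muln_gt0 d1_gt0 d2_gt0.
have PE : P = Ar * br + ar * Br - ar * br.
  by rewrite /P !natrM -area /Ar /Br /ar /br !natrM; ring.
set g := (F3 + d1 + d2 + d3)%:R.
have g_gt0 : 0 < g by rewrite ltr0n; lia.
have {}leA : Ar <= ar + Br by rewrite -natrD ler_nat.
have {}leB : Br <= Ar + br by rewrite -natrD ler_nat.
have {}le_aA : ar <= Ar by rewrite ler_nat leq_mul.
have {}le_bB : br <= Br by rewrite ler_nat leq_mul.
have ar_ge0 : 0 <= ar by apply: ler0n.
have br_ge0 : 0 <= br by apply: ler0n.
have bounds : 3 * (P * g ^+ 4) <=
    (Ar + br) ^+ 6 + (ar + Br) ^+ 6 - (Ar ^+ 6 + Br ^+ 6 + (ar + br) ^+ 6)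
    <= 26 / 3 * (P * g ^+ 4).
  have [le|/ltnW le] := leqP (a * d2 + B * d3) (A * d2 + b * d3).
    have -> : g = Ar + br by rewrite /g gE (maxn_idPl le) natrD.
    have {}le : ar + Br <= Ar + br by rewrite -!natrD ler_nat.
    by apply: sixth_moment_bounds; rewrite ?PE; try lra; ring.
  have -> : g = ar + Br by rewrite /g gE (maxn_idPr le) natrD.
  have {}le : Ar + br <= ar + Br by rewrite -!natrD ler_nat.
  rewrite [X in X - _]addrC.
  by apply: sixth_moment_bounds; rewrite ?PE; try lra; ring.
have genusE : genusK d1 d2 d3 Q 3 = ((Ar + br) ^+ 6 + (ar + Br) ^+ 6
    - (Ar ^+ 6 + Br ^+ 6 + (ar + br) ^+ 6)) / (120 * P).
  rewrite /genusK QE power_moment_syzygies; last by [].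
  by rewrite !natrD; congr (_ / (_ * _)).
have := rescaled_genus_bounds _ _ _ _ _ P_gt0 g_gt0 genusE bounds.
cbv zeta.
(* numerals above 5000 are not expanded, hence not read by lra *)
have big : 7515%:R = 75 * 100 + 15 :> rat.
  by rewrite -natrM -natrD; congr (_%:R).
rewrite big => /andP [lo hi]; apply/andP; split.
  by apply: lt_le_trans lo; lra.
by apply: le_lt_trans hi _; lra.
Qed.
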